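(* In a planar motion of a rigid body there is a specific pole $P_k$ for which the acceleration of order $k$ is zero, $\mathbf r_{P_k}^{(k)}=\mathbf 0$. That acceleration pole of order $k$, observed from a body point $A$, is obtained by $$\mathbf r_{AP_k}=\frac{\Omega_r^{(k)}\,\mathbf r_A^{(k)}+\Omega_t^{(k)}\,\tilde{\mathbf r}_A^{(k)}}{\Omega_r^{(k)2}+\Omega_t^{(k)2}},$$ where the translational acceleration $\mathbf r_A^{(k)}$ of order $k$ of the point $A$ as well as the body's radial and tangential angular acceleration state $\Omega_r^{(k)}$ and $\Omega_t^{(k)}$ of order $k$ are known.
   Context: $\mathbf J=\begin{pmatrix}0&-1\\1&0\end{pmatrix}$ and $\tilde{\mathbf a}=\mathbf J\mathbf a$ for $\mathbf a\in\mathbb R^2$; in particular $\tilde{\mathbf r}_A^{(k)}=\mathbf J\mathbf r_A^{(k)}$. $\mathbf r_A$ is the position of the point $A$ and $\mathbf r_{AB}=\mathbf r_B-\mathbf r_A$ is the vector from $A$ to $B$. The rigid body has angular velocity $\omega$, i.e. $\dot{\mathbf r}_{AB}=\omega\,\tilde{\mathbf r}_{AB}$ for all pairs of points $A,B$ fixed to the body (the body is identified with an unbounded moving plane, and $P_k$ is a point of this plane). The ''acceleration of order $k$'' of a body point $B$ is the $k$-th time derivative $\mathbf r_B^{(k)}$ of its position ($k=1$ velocity, $k=2$ acceleration, $k=3$ jerk, and so on). The scalars $\Omega_r^{(k)},\Omega_t^{(k)}$ are the radial and tangential angular components of order $k$, defined by $\Omega_r^{(0)}=-1$, $\Omega_t^{(0)}=0$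 and $\Omega_r^{(k+1)}=\dot\Omega_r^{(k)}+\omega\,\Omega_t^{(k)}$, $\Omega_t^{(k+1)}=\dot\Omega_t^{(k)}-\omega\,\Omega_r^{(k)}$ (superscript an index, dot a time derivative), so that $\mathbf r_B^{(k)}=\mathbf r_A^{(k)}-\Omega_r^{(k)}\mathbf r_{AB}+\Omega_t^{(k)}\tilde{\mathbf r}_{AB}$. All functions are sufficiently often differentiable. *)

(* Defs.v *)
From HB Require Import structures.
From mathcomp Require Import all_boot all_order all_algebra.
From mathcomp Require Import all_classical all_reals all_analysis.

Set Implicit Arguments.
Unset Strict Implicit.
Unset Printing Implicit Defensive.

Import Order.TTheory GRing.Theory Num.Theory.
Import numFieldNormedType.Exports.

Local Open Scope classical_set_scope.
Local Open Scope ring_scope.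

Definition J {R : realType} : 'M[R]_2 :=
  \matrix_(i, j) nth 0 (nth [::] [:: [:: 0; -1]; [:: 1; 0]] i) j.

Definition tilde {R : realType} (a : 'cV[R]_2) : 'cV[R]_2 := J *m a.

(* [r A s] is the position, at time [s], of the body point [A], and
   [rel_pos r A B s] is the vector from [A] to [B] at that time. *)
Definition rel_pos {R : realType} {body : Type} (r : body -> R -> 'cV[R]_2)
  (A B : body) (s : R) : 'cV[R]_2 := r B s - r A s.

(* The acceleration of order [k] of the body point [A] is the derivative of the
   trajectory of that fixed point of the body. *)
Definition accel {R : realType} {body : Type} (r : body -> R -> 'cV[R]_2)
  (k : nat) (A : body) (s : R) : 'cV[R]_2 := derive1n k (r A) s.

(* [f], ..., f^(n-1) are all differentiable at each point of [I]; with [I]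
   open this says that [f] is [n] times differentiable on [I]. *)
Definition n_derivable_on {R : realType} {V : normedModType R} (n : nat)
  (I : set R) (f : R -> V) : Prop :=
  forall j, (j < n)%N -> forall s, I s -> derivable (derive1n j f) s 1.

(* The abstract type [body] collects the points fixed to the body.  Since the
   body is an unbounded moving plane, at every time each point of the plane is
   occupied by exactly one body point.  On an interval the velocity law makes
   the vectors [rel_pos r A B] rotate, so that distances are preserved. *)
Record rigid_motion {R : realType} {body : Type} (I : set R)
    (r : body -> R -> 'cV[R]_2) (omega : R -> R) : Prop := RigidMotion {
  rigid_plane : forall s, I s -> bijective (fun A => r A s);
  rigid_velocity : forall A B s, I s ->
    derivable (rel_pos r A B) s 1 /\
    derive1 (rel_pos r A B) s = omega s *: tilde (rel_pos r A B s) }.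

Fixpoint Omega_r {R : realType} (omega : R -> R) (k : nat) : R -> R :=
  if k is k'.+1 then
    fun s => derive1 (Omega_r omega k') s + omega s * Omega_t omega k' s
  else fun=> -1
with Omega_t {R : realType} (omega : R -> R) (k : nat) : R -> R :=
  if k is k'.+1 then
    fun s => derive1 (Omega_t omega k') s - omega s * Omega_r omega k' s
  else fun=> 0.

(* Main.v *)
(** Differentiating the velocity law [k] times gives
    [r_B^(k) = r_A^(k) - Omega_r^(k) r_AB + Omega_t^(k) J r_AB].  As
    [J^2 = -1], the map [w |-> Omega_r w - Omega_t J w] is multiplication by a
    complex number of square modulus [Omega_r^2 + Omega_t^2], so the equation
    [r_B^(k) = 0] has exactly one solution [r_AB] as soon as this modulus is
    nonzero. *)
Require Import Defs.
From mathcomp Require Import all_boot all_order all_algebra.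
From mathcomp Require Import all_classical all_reals all_analysis.
From mathcomp Require Import ring.

Import Order.TTheory GRing.Theory Num.Theory.
Import numFieldNormedType.Exports.

Local Open Scope classical_set_scope.
Local Open Scope ring_scope.

(** Entrywise differentiation carries the scalar sum and product rules over to the matrix-valued
    maps below. *)
Lemma is_derive_mxP (R : realFieldType) (V : normedModType R) (m n : nat)
    (M : V -> 'M[R]_(m, n)) (x v : V) (dM : 'M[R]_(m, n)) :
  is_derive x v M dM <-> forall i j, is_derive x v (fun y => M y i j) (dM i j).
Proof.
split=> [[dfM <-] i j|dfM].
  apply: DeriveDef; first exact: (derivable_mxP _ _ _).1.
  by rewrite derive_mx// mxE.
have Mx : derivable M x v by apply/derivable_mxP => i j; case: (dfM i j).
apply: DeriveDef => //; rewrite derive_mx//.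
by apply/matrixP => i j; rewrite mxE; case: (dfM i j).
Qed.

Lemma is_derive_scalemx {R : realFieldType} {V : normedModType R} {m n : nat}
    {f : V -> R} {M : V -> 'M[R]_(m, n)} {x v : V} {df : R}
    {dM : 'M[R]_(m, n)} :
  is_derive x v f df -> is_derive x v M dM ->
  is_derive x v (fun y => f y *: M y) (df *: M x + f x *: dM).
Proof.
move=> ff /is_derive_mxP fM; apply/is_derive_mxP => i j.
have -> : (fun y => (f y *: M y) i j) = f * (fun y => M y i j).
  by apply/funext => y; rewrite mxE.
by apply: is_derive_eq; rewrite !mxE addrC; congr (_ + _); exact: mulrC.
Qed.

Lemma is_derive_mulmxl {R : realFieldType} {V : normedModType R} {m n p : nat}
    (A : 'M[R]_(m, n)) {M : V -> 'M[R]_(n, p)} {x v : V} {dM : 'M[R]_(n, p)} :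
  is_derive x v M dM -> is_derive x v (fun y => A *m M y) (A *m dM).
Proof.
move=> /is_derive_mxP fM; apply/is_derive_mxP => i j.
have -> : (fun y => (A *m M y) i j) = \sum_k (A i k *: (fun y => M y k j)).
  by apply/funext => y; rewrite mxE fct_sumE.
by apply: is_derive_eq; rewrite mxE.
Qed.

Lemma lift0_ord2 : lift 0 0 = 1 :> 'I_2.
Proof. exact/val_inj. Qed.

Lemma tildeE0 (R : realType) (a : 'cV[R]_2) : tilde a 0 0 = - a 1 0.
Proof.
rewrite /tilde mxE !big_ord_recl big_ord0 !mxE/= lift0_ord2.
by rewrite mul0r add0r addr0 mulN1r.
Qed.

Lemma tildeE1 (R : realType) (a : 'cV[R]_2) : tilde a 1 0 = a 0 0.
Proof.
by rewrite /tilde mxE !big_ord_recl big_ord0 !mxE/= mul0r !addr0 mul1r.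
Qed.

Lemma cV2P {R : nzRingType} (a b : 'cV[R]_2) :
  a 0 0 = b 0 0 -> a 1 0 = b 1 0 -> a = b.
Proof.
move=> ab0 ab1; apply/matrixP => i j; rewrite (ord1 j).
by case: (unliftP 0 i) => [k ->|->//]; rewrite (ord1 k) lift0_ord2.
Qed.

(** With [tilde] read as multiplication by $i$, the equation is $a = (p - iq) w$, and the conjugate
    $p + iq$ inverts it. *)
Lemma tilde_solve {R : realType} {p q : R} (a w : 'cV[R]_2) :
  p ^+ 2 + q ^+ 2 != 0 ->
  a - p *: w + q *: tilde w = 0 <->
  w = (p ^+ 2 + q ^+ 2)^-1 *: (p *: a + q *: tilde a).
Proof.
move=> pq0; split=> [/matrixP aw|->].
  have [aw0 aw1] := (aw 0 0, aw 1 0).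
  rewrite !(tildeE0, tildeE1, mxE) in aw0 aw1.
  (* Solving the coordinates for [a] instead of [w] needs no division; substitution then leaves an
     identity in [w] with denominator $p^2 + q^2$. *)
  have a0 : a 0 0 = p * w 0 0 + q * w 1 0.
    apply/eqP; rewrite -subr_eq0 -aw0; apply/eqP; ring.
  have a1 : a 1 0 = p * w 1 0 - q * w 0 0.
    apply/eqP; rewrite -subr_eq0 -aw1; apply/eqP; ring.
  by apply/cV2P; rewrite !(tildeE0, tildeE1, mxE) a0 a1; field.
by apply/cV2P; rewrite !(tildeE0, tildeE1, mxE); field.
Qed.

Section higher_derivability.
Set Implicit Arguments.
Unset Strict Implicit.
Context {R : realType} {I : set R} (I_open : open I).

(** Peeling off the first derivative, not the last, makes the closure properties below provable by
    induction on the order, for all functions at once. *)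
Lemma n_derivable_onS (V : normedModType R) n (f : R -> V) :
  n_derivable_on n.+1 I f <->
  (forall s, I s -> derivable f s 1) /\ n_derivable_on n I (derive1 f).
Proof.
split=> [fn|[f1 fn] [|j] jn s Is]; last 2 first.
- exact: f1.
- by rewrite derive1Sn; exact: fn.
split=> [s|j jn s Is]; first exact: (fn 0%N).
by rewrite -derive1Sn; exact: fn.
Qed.

Lemma n_derivable_on_leq (V : normedModType R) m n (f : R -> V) :
  (m <= n)%N -> n_derivable_on n I f -> n_derivable_on m I f.
Proof. by move=> mn fn j jm; apply: fn; exact: leq_trans mn. Qed.

Lemma near_eq_open (T : Type) (f g : R -> T) s :
  (forall s, I s -> f s = g s) -> I s -> \near s, f s = g s.
Proof.
by move=> fg Is; near=> u; apply: fg; near: u; exact: open_nbhs_nbhs.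
Unshelve. all: by end_near. Qed.

(** Since [I] is open, equality on [I] is equality near each of its points, so derivatives agree
    there. This allows a derivative to be replaced by a formula valid on [I] only. *)
Lemma eq_n_derivable_on (V : normedModType R) n (f g : R -> V) :
  (forall s, I s -> f s = g s) -> n_derivable_on n I f -> n_derivable_on n I g.
Proof.
elim: n f g => [//|n IHn] f g fg /n_derivable_onS[f1 fn].
apply/n_derivable_onS; split=> [s Is|].
  exact: near_eq_derivable (near_eq_open fg Is) (f1 _ Is).
apply: IHn fn => s Is.
by rewrite !derive1E; apply: near_eq_derive; exact: near_eq_open.
Qed.

Lemma n_derivable_on_cst (V : normedModType R) n (c : V) :
  n_derivable_on n I (cst c).
Proof.
elim: n c => [//|n IHn] c; apply/n_derivable_onS; split=> [s _|].
  exact: derivable_cst.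
by apply: eq_n_derivable_on (IHn 0) => s _; rewrite derive1_cst.
Qed.

Lemma n_derivable_onD (V : normedModType R) n (f g : R -> V) :
  n_derivable_on n I f -> n_derivable_on n I g -> n_derivable_on n I (f + g).
Proof.
elim: n f g => [//|n IHn] f g /n_derivable_onS[f1 fn] /n_derivable_onS[g1 gn].
apply/n_derivable_onS; split=> [s Is|]; first by apply: derivableD; auto.
apply: eq_n_derivable_on (IHn _ _ fn gn) => s Is.
by rewrite derive1E deriveD -?derive1E; auto.
Qed.

Lemma n_derivable_onN (V : normedModType R) n (f : R -> V) :
  n_derivable_on n I f -> n_derivable_on n I (- f).
Proof.
elim: n f => [//|n IHn] f /n_derivable_onS[f1 fn].
apply/n_derivable_onS; split=> [s Is|]; first by apply: derivableN; auto.
apply: eq_n_derivable_on (IHn _ fn) => s Is.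
by rewrite derive1E deriveN -?derive1E; auto.
Qed.

Lemma n_derivable_onM n (f g : R -> R) :
  n_derivable_on n I f -> n_derivable_on n I g -> n_derivable_on n I (f * g).
Proof.
elim: n f g => [f g _ _ j|n IHn f g fn1 gn1]; first by rewrite ltn0.
have [f1 fn] := (n_derivable_onS _ _).1 fn1.
have [g1 gn] := (n_derivable_onS _ _).1 gn1.
apply/n_derivable_onS; split=> [s Is|]; first by apply: derivableM; auto.
(* The Leibniz terms $f g'$ and $g f'$ also contain the undifferentiated factors, whose order is
   lowered to fit the induction hypothesis. *)
have fn0 := n_derivable_on_leq (leqnSn n) fn1.
have gn0 := n_derivable_on_leq (leqnSn n) gn1.
apply: eq_n_derivable_on (n_derivable_onD (IHn _ _ fn0 gn) (IHn _ _ gn0 fn)).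
by move=> s Is; rewrite [RHS]derive1E deriveM -?derive1E; auto.
Qed.

(** Each step of the recursion spends one derivative, so the components of order [j] keep [k - j] of
    them. Order 0 is constant and order 1 involves [omega] undifferentiated, whence the bound
    [k.-1]. *)
Lemma n_derivable_on_Omega (omega : R -> R) k :
  n_derivable_on k.-1 I omega -> forall j m, (j + m <= k)%N ->
  n_derivable_on m I (Omega_r omega j) /\ n_derivable_on m I (Omega_t omega j).
Proof.
move=> omega_k; elim=> [m _|j IHj m jmk].
  by split; exact: n_derivable_on_cst.
have [Or Ot] : n_derivable_on m.+1 I (Omega_r omega j) /\
    n_derivable_on m.+1 I (Omega_t omega j) by apply: IHj; rewrite addnS.
have omega_m : n_derivable_on m I omega.
  apply: n_derivable_on_leq omega_k; rewrite -ltnS.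
  rewrite (leq_trans _ (leqSpred k))// (leq_trans _ jmk)// addSn ltnS.
  exact: leq_addl.
have Or0 := n_derivable_on_leq (leqnSn m) Or.
have Ot0 := n_derivable_on_leq (leqnSn m) Ot.
move: Or Ot => /n_derivable_onS[_ Or1] /n_derivable_onS[_ Ot1].
have M f := n_derivable_onM omega_m (g := f).
split; first exact: n_derivable_onD Or1 (M _ Ot0).
exact: n_derivable_onD Ot1 (n_derivable_onN (M _ Or0)).
Qed.

End higher_derivability.

Section rigid_motion.
Set Implicit Arguments.
Unset Strict Implicit.
Context {R : realType} {body : Type} {I : set R} {r : body -> R -> 'cV[R]_2}
  {omega : R -> R} (I_open : open I) (motion : rigid_motion I r omega).

Lemma is_derive_rel_pos A B s : I s ->
  is_derive s 1 (rel_pos r A B) (omega s *: tilde (rel_pos r A B s)).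
Proof.
move=> Is; have [d1 <-] := rigid_velocity motion A B Is.
by rewrite derive1E; exact: derivableP.
Qed.

(** Induction on the order. At order 0, $\Omega_r^{(0)} = -1$ gives $r_B = r_A + r_{AB}$;
    differentiating the formula of order [j] reproduces the recursion of the components. *)
Lemma accelE (k : nat) : (forall A, n_derivable_on k I (r A)) ->
  n_derivable_on k.-1 I omega ->
  forall j, (j <= k)%N -> forall A B s, I s ->
  accel r j B s = accel r j A s - Omega_r omega j s *: rel_pos r A B s
                  + Omega_t omega j s *: tilde (rel_pos r A B s).
Proof.
move=> r_smooth omega_smooth; elim=> [_ A B s _|j IHj jk A B s Is].
  by rewrite /accel/= scaleN1r opprK scale0r addr0 /rel_pos addrC subrK.
have [/(_ 0%N isT _ Is)/derivableP Or /(_ 0%N isT _ Is)/derivableP Ot] :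
    n_derivable_on 1 I (Omega_r omega j) /\
    n_derivable_on 1 I (Omega_t omega j).
  by apply: (n_derivable_on_Omega I_open omega_smooth); rewrite addn1.
rewrite -!derive1E in Or Ot.
have /derivableP dA := r_smooth A j jk s Is.
have drel := is_derive_rel_pos A B Is.
have dB := is_deriveD (is_deriveB dA (is_derive_scalemx Or drel))
  (is_derive_scalemx Ot (is_derive_mulmxl J drel)).
(* The induction hypothesis holds on all of the open set [I], hence near [s], so both sides may be
   differentiated at [s]. *)
have eqB : \near s, accel r j A s - Omega_r omega j s *: rel_pos r A B s
    + Omega_t omega j s *: tilde (rel_pos r A B s) = accel r j B s.
  by apply: (near_eq_open I_open _ Is) => u Iu;
    rewrite -(IHj (ltnW jk) A B u Iu).
have [_] := near_eq_is_derive eqB dB.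
rewrite -!derive1E -!derive1nS -!/(accel r _ _ _) => ->.
rewrite -/(tilde _).
(* In coordinates $J^2 = -1$ is built in: the term $\Omega_t^{(j)} \omega J^2 r_{AB}$ joins the
   radial part, and $-\Omega_r^{(j)} \omega J r_{AB}$ the tangential one. *)
by apply/cV2P; rewrite /= !(tildeE0, tildeE1, mxE); ring.
Qed.

End rigid_motion.

Theorem theorem4p3 (R : realType) (body : Type) (I : set R)
    (r : body -> R -> 'cV[R]_2) (omega : R -> R) (k : nat)
    (I_open : open I) (I_itv : is_interval I)
    (motion : rigid_motion I r omega)
    (k_gt0 : (0 < k)%N)
    (r_smooth : forall A, n_derivable_on k I (r A))
    (omega_smooth : n_derivable_on k.-1 I omega)
    (t : R) (It : I t)
    (Omega_neq0 : Omega_r omega k t ^+ 2 + Omega_t omega k t ^+ 2 != 0) :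
  (exists! P : body, accel r k P t = 0) /\
  (forall P A : body, accel r k P t = 0 ->
     rel_pos r A P t =
       (Omega_r omega k t ^+ 2 + Omega_t omega k t ^+ 2)^-1 *:
         (Omega_r omega k t *: accel r k A t
          + Omega_t omega k t *: tilde (accel r k A t))).
Proof.
have accelP A P := accelE I_open motion r_smooth omega_smooth (leqnn k) A P It.
have poleP A P : accel r k P t = 0 <->
    rel_pos r A P t = (Omega_r omega k t ^+ 2 + Omega_t omega k t ^+ 2)^-1 *:
      (Omega_r omega k t *: accel r k A t
       + Omega_t omega k t *: tilde (accel r k A t)).
  by rewrite (accelP A); exact: tilde_solve.
split; last by move=> P A /(poleP A).
(* [g] returns the body point occupying a given place at time [t]. The observer [A] is the one at
   the origin, a choice that only supplies some body point. *)
have [g gK Kg] := rigid_plane motion It; pose A := g 0.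
pose w := (Omega_r omega k t ^+ 2 + Omega_t omega k t ^+ 2)^-1 *:
  (Omega_r omega k t *: accel r k A t
   + Omega_t omega k t *: tilde (accel r k A t)).
(* The pole is the body point found at displacement [w] from [A]. Any other pole has the same
   displacement, hence the same place, and [g] identifies the two. *)
exists (g (r A t + w)); split=> [|P /(poleP A) AP].
  by apply/(poleP A); rewrite /rel_pos Kg addrC addKr.
by rewrite /w -AP /rel_pos addrC subrK gK.
Qed.
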